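(* Let $\mathscr{F}$ be a maximal weakly separated family of triangles in $[n]$, let $x\in[n]$, and let $v_1<_x\dots<_x v_r$ be the triangulation points of $\mathscr{F}_x$. Let $B:=v_i$ be a triangulation point. Let $P_1,\dots,P_s$ be the leaves in $B$, ordered with respect to $<_x$. Let $P_0:=v_{i-1}$ be the preceding triangulation point and $P_{s+1}:=v_{i+1}$ the next triangulation point (with the conventions $v_0=v_r$ and $v_{r+1}=v_1$). Then the triangles $\{B,P_j,P_{j+1}\}$ for $0\le j\le s$ are all elements of $\mathscr{F}$, except possibly if $B=v_1$ and $j=0$, or $B=v_r$ and $j=s$.
   Context: Let $[n]=\{1,\dots,n\}$. A tuple $(a_1,\dots,a_r)$, $r\ge 3$, of pairwise distinct elements of $[n]$ is cyclically ordered if $a_1<\dots<a_r$ or there is $2\le i\le r$ with $a_i<a_{i+1}<\dots<a_r<a_1<\dots<a_{i-1}$. For distinct $a,b\in[n]\setminus\{x\}$ write $a<_x b$ if $(x,a,b)$ is cyclically ordered; this is a total order on $[n]\setminus\{x\}$. A triangle is a subset of $[n]$ with exactly $3$ elements. Two triangles $A,B$ are crossing if there are $a,c\in A\setminus B$ and $b,d\in B\setminus A$ such that $(a,b,c,d)$ is cyclically ordered; otherwise they are weakly separated. A weakly separated family of triangles is a set of pairwise non-crossing triangles in $[n]$; it is maximal if it is not properly contained in another weakly separated family of triangles in $[n]$. Put $\mathscr{F}_x=\{C\in\mathscr{F}\mid x\in C\}$. The graph $G(\mathscr{F}_x)$ has as vertices the elements of $[n]\setminus\{x\}$ that occur in some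 triangle of $\mathscr{F}_x$, and has an edge between $a$ and $b$ for every triangle $\{x,a,b\}\in\mathscr{F}_x$. The vertices of $G(\mathscr{F}_x)$ of degree at least $2$ are called the triangulation points of $\mathscr{F}_x$. A vertex of degree $1$ whose edge connects it to the triangulation point $v_i$ is called a leaf in $v_i$. *)

(* Defs.v *)
From mathcomp Require Import all_boot.

Set Implicit Arguments.
Unset Strict Implicit.
Unset Printing Implicit Defensive.

(* The ground set [n] = {1, ..., n} is 'I_n, i.e. {0, ..., n-1} with the same
   linear order. *)

Section WeaklySeparatedTriangles.

Variable n : nat.
Implicit Types (x a b c d : 'I_n) (A B C : {set 'I_n}) (F : {set {set 'I_n}}).

(* Some rotation of the tuple is strictly increasing; in particular its
   entries are pairwise distinct. *)
Definition cyclically_ordered (s : seq 'I_n) : bool :=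
  [exists k : 'I_(size s), sorted ltn (map val (rot k s))].

(* The relation a <_x b; it is false if x, a, b are not pairwise distinct. *)
Definition lt_from x : rel 'I_n :=
  fun a b => cyclically_ordered [:: x; a; b].

Definition triangle A : bool := #|A| == 3.

Definition crossing A B : bool :=
  [exists a in A :\: B, exists c in A :\: B,
   exists b in B :\: A, exists d in B :\: A,
     cyclically_ordered [:: a; b; c; d]].

Definition weakly_separated_family F : bool :=
  [forall A in F, triangle A]
  && [forall A in F, forall B in F, ~~ crossing A B].

Definition maximal_weakly_separated_family F : bool :=
  maxset weakly_separated_family F.

Definition star F x : {set {set 'I_n}} := [set C in F | x \in C].

Definition graph_vertices F x : {set 'I_n} :=
  [set a | (a != x) && [exists C in star F x, a \in C]].

Definition graph_edge F x : rel 'I_n :=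
  fun a b => uniq [:: x; a; b] && ([set x; a; b] \in star F x).

(* A triangle {x, a, b} is determined by {a, b}, so the graph is simple and the
   degree is the number of neighbours. *)
Definition degree F x a : nat := #|[set b | graph_edge F x a b]|.

Definition triangulation_points F x : {set 'I_n} :=
  [set a in graph_vertices F x | 2 <= degree F x a].

Definition leaves F x b : {set 'I_n} :=
  [set a in graph_vertices F x | (degree F x a == 1) && graph_edge F x a b].

End WeaklySeparatedTriangles.

(* Main.v *)
Require Import Defs.
From mathcomp Require Import all_boot.
From mathcomp Require Import zify.

(** Cut the circle at [x] and order all points by their distance [rank] from
    [x].  Two triangles cross when two points of one, outside the other,
    separate two points of the other, outside the first.  By maximality, a
    triangle crossed by no member of the family is a member.  So the graph of
    [x] is studied by asking which members can cross a given triangle.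

    The members [C] that do not contain [x] constrain this graph through the
    points strictly inside their span.  Call [y] shadowed if some member
    [C = {c < d < e}] without [x] and without [y] satisfies [c < y < e].  If
    [y] is an endpoint of an edge, then its other endpoint must be the point
    of [C] that is alone on its side of [y], namely [c] if [c < y < d] and
    [e] if [d < y < e]; otherwise [C] crosses the triangle of that edge
    ([shadow_edge]).  Three consequences carry the proof.
    - A shadowed point has at most one neighbor, and the points between it
      and that neighbor are shadowed and have no other neighbor either
      ([shadowed_unique_neighbor], [shadowed_between], [edge_between]).
    - Two shadowed points are never joined, because the two members that
      shadow them would cross ([shadowed_stable]).
    - Two consecutive points that are not shadowed are joined: a member that
      crosses their triangle would force one of them to be shadowed
      ([consecutive_edge]).
    Hence for [n >= 4] the triangulation points are exactly the points that
    are not shadowed ([mem_triangulation_points]), consecutive ones are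
    joined, and everything strictly between a leaf and the point it hangs
    from is shadowed.

    Now let [p < q] be consecutive among the neighbors of [b] listed in the
    theorem.  A member crossing [{b, p, q}] but neither [{x, b, p}] nor
    [{x, b, q}] must contain [x], so it is an edge [f - h] of the graph with
    [f] inside the span of [{b, p, q}] ([crossing_fan]).  Such an [f] is
    shadowed, so [h] is not, and no vertex of the triangle lies between them;
    this leaves only [h = b], against the choice of [p] and [q], or an [h]
    for which there is no crossing ([fan_triangle]). *)

Set Implicit Arguments.
Unset Strict Implicit.
Unset Printing Implicit Defensive.

(** * The order seen from a base point *)

Section Rank.

Variables (n : nat) (x : 'I_n).
Implicit Types (a b c d : 'I_n) (A B : {set 'I_n}).

Definition rank a : nat := if x <= a then a - x else a + n - x.

Lemma rankE a : (x <= a /\ rank a = a - x) \/ (a < x /\ rank a = a + n - x).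
Proof. by rewrite /rank; case: leqP; [left | right]. Qed.

Lemma rank_base : rank x = 0.
Proof. by rewrite /rank leqnn subnn. Qed.

Lemma ltn_rank a : rank a < n.
Proof. by have := ltn_ord a; have := ltn_ord x; have := rankE a; lia. Qed.

Lemma rank_inj : injective rank.
Proof.
move=> a b eq_ab; have := ltn_ord a; have := ltn_ord b; have := ltn_ord x.
by have := rankE a; have := rankE b => *; apply: val_inj => /=; lia.
Qed.

(** The cut at [x] moves the points before [x] behind all others; this form
    reduces comparisons of ranks to comparisons of the points by cases. *)
Lemma rank_lt a b :
  (rank a < rank b) = if (x <= a) == (x <= b) then a < b else x <= a.
Proof.
have [ltb ltx] := (ltn_ord b, ltn_ord x).
have [lta [rb ra]] := (ltn_ord a, (rankE b, rankE a)).
by have [xa|ax] := leqP x a; have [xb|bx] := leqP x b => /=; lia.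
Qed.

Lemma eq_rank a b : (rank a == rank b) = (a == b).
Proof. exact: inj_eq rank_inj a b. Qed.

Lemma rank_gt0 a : (0 < rank a) = (a != x).
Proof. by rewrite lt0n -{1}rank_base eq_rank. Qed.

Lemma rank_surj k : k < n -> exists a, rank a = k.
Proof.
move=> lt_kn; have ltx := ltn_ord x; have [lt_kxn|le_nkx] := ltnP (k + x) n.
  by exists (Ordinal lt_kxn); have /= := rankE (Ordinal lt_kxn); lia.
have lt_an : k + x - n < n by lia.
by exists (Ordinal lt_an); have /= := rankE (Ordinal lt_an); lia.
Qed.

Lemma lt_fromE a b : lt_from x a b = (0 < rank a < rank b).
Proof.
have := (ltn_ord a, ltn_ord b, ltn_ord x, rankE a, rankE b).
case=> -[] [] [] lta ltb ltx ra rb.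
rewrite /lt_from /cyclically_ordered; apply/existsP/idP => [[]|lt_ab].
  by case=> [[|[|[|k]]] lek] //=; rewrite /rot /=; lia.
have: [|| x < a < b, a < b < x | b < x < a] by lia.
by case/or3P=> ord; [exists (@Ordinal 3 0 isT) | exists (@Ordinal 3 1 isT)
  | exists (@Ordinal 3 2 isT)]; rewrite /rot /=; lia.
Qed.

(** A cyclic order survives rotation, so it can be read off the ranks instead
    of the points themselves. *)
Lemma cyclically_ordered4E a b c d :
  cyclically_ordered [:: a; b; c; d] =
  [|| [&& rank a < rank b, rank b < rank c & rank c < rank d],
      [&& rank b < rank c, rank c < rank d & rank d < rank a],
      [&& rank c < rank d, rank d < rank a & rank a < rank b]
    | [&& rank d < rank a, rank a < rank b & rank b < rank c]].
Proof.
have -> : cyclically_ordered [:: a; b; c; d] =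
    [|| [&& a < b, b < c & c < d], [&& b < c, c < d & d < a],
        [&& c < d, d < a & a < b] | [&& d < a, a < b & b < c]].
  rewrite /cyclically_ordered; apply/existsP/idP => [[]|/or4P ord].
    case=> [[|[|[|[|k]]]] lek] //=; rewrite /rot /= !andbT => ->;
      by rewrite ?orbT.
  by case: ord => ord; [exists (@Ordinal 4 0 isT) | exists (@Ordinal 4 1 isT)
    | exists (@Ordinal 4 2 isT) | exists (@Ordinal 4 3 isT)];
    rewrite /rot /= !andbT.
rewrite !rank_lt; have [xa|ax] := leqP x a; have [xb|bx] := leqP x b;
  have [xc|cx] := leqP x c; have [xd|dx] := leqP x d => /=; lia.
Qed.

Definition between a b y : bool :=
  (rank a < rank y < rank b) || (rank b < rank y < rank a).

(** The chords [f g] and [a b] cross when the four points are distinct. *)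
Definition separates f g a b : bool := between a b f (+) between a b g.

(** Once the circle is cut at the base point, exactly one of the two points of
    [B] is between the two points of [A].  Calling it [f] lets one linear
    pattern of ranks cover all rotations. *)
Lemma crossing_ranks A B : crossing A B ->
  exists s t f g,
    [/\ s \in A :\: B, t \in A :\: B, f \in B :\: A, g \in B :\: A
    & (rank s < rank f < rank t) && ((rank g < rank s) || (rank t < rank g))].
Proof.
case/exists_inP=> a aA /exists_inP[c cA] /exists_inP[b bB] /exists_inP[d dB].
rewrite cyclically_ordered4E => /or4P[]/and3P[o1 o2 o3].
- by exists a, c, b, d; rewrite o1 o2 o3 orbT.
- by exists c, a, d, b; rewrite o1 o2 o3.
- by exists c, a, d, b; rewrite o1 o2 o3 orbT.
- by exists a, c, b, d; rewrite o1 o2 o3.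
Qed.

Lemma separates_crossing A B s t f g :
  s \in A :\: B -> t \in A :\: B -> f \in B :\: A -> g \in B :\: A ->
  separates f g s t -> crossing A B.
Proof.
have neq a b : a \in A :\: B -> b \in B :\: A -> rank a != rank b.
  move=> /setDP[aA _] /setDP[_ bA]; rewrite eq_rank.
  by apply: contraNneq bA => <-.
move=> sA tA fB gB; rewrite /separates /between => sep.
have cross a b c d : a \in A :\: B -> c \in A :\: B -> b \in B :\: A ->
    d \in B :\: A -> cyclically_ordered [:: a; b; c; d] -> crossing A B.
  move=> aA cA bB dB ord.
  apply/exists_inP; exists a => //; apply/exists_inP; exists c => //.
  by apply/exists_inP; exists b => //; apply/exists_inP; exists d.
suff /orP[|] : cyclically_ordered [:: s; f; t; g] ||
    cyclically_ordered [:: s; g; t; f] by apply: cross.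
rewrite !cyclically_ordered4E; move: (neq _ _ sA fB) (neq _ _ sA gB) sep.
by move: (neq _ _ tA fB) (neq _ _ tA gB); clear; lia.
Qed.

End Rank.

(** * Sets with three elements *)

Section ThreeElements.

Variable T : finType.

Lemma card_set3 (a b c : T) :
  a != b -> a != c -> b != c -> #|[set a; b; c]| = 3.
Proof.
move=> ab ac bc; rewrite setUC cardsU1 cards2 ab !inE.
by rewrite eq_sym (negPf ac) eq_sym (negPf bc).
Qed.

Lemma triangle_third (C : {set T}) (a b : T) :
  #|C| = 3 -> exists2 c, c \in C & (c != a) && (c != b).
Proof.
move=> cardC; have: 0 < #|C :\: [set a; b]|.
  rewrite cardsD cardC subn_gt0 ltnS.
  apply: leq_trans (subset_leq_card (subsetIr _ _)) _.
  by rewrite cards2; case: (a != b).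
by case/card_gt0P=> c; rewrite !inE negb_or => /andP[]; exists c.
Qed.

Lemma triangle_eq (C : {set T}) (a b c : T) :
  #|C| = 3 -> a \in C -> b \in C -> c \in C ->
  a != b -> a != c -> b != c -> C = [set a; b; c].
Proof.
move=> cardC aC bC cC ab ac bc; apply/esym/eqP.
rewrite eqEcard cardC card_set3 // andbT.
by apply/subsetP=> z; rewrite !inE => /orP[/orP[]|] /eqP->.
Qed.

End ThreeElements.

(** * Members of a maximal family and the graph of a point *)

Section MaximalFamily.

Variables (n : nat) (F : {set {set 'I_n}}).
Hypothesis F_max : maximal_weakly_separated_family F.
Variable x : 'I_n.
Implicit Types (a b c y z : 'I_n) (A B C : {set 'I_n}).

Local Notation rk := (rank x).
Local Notation between := (between x).
Local Notation separates := (separates x).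
Local Notation edge := (graph_edge F x).

Lemma family_triangle C : C \in F -> #|C| = 3.
Proof.
by case/maxsetP: F_max => /andP[/forall_inP tF _] _ /tF/eqP.
Qed.

Lemma family_noncrossing A B : A \in F -> B \in F -> ~~ crossing A B.
Proof.
by case/maxsetP: F_max => /andP[_ /forall_inP nF] _ /nF/forall_inP; apply.
Qed.

Lemma no_separation A B s t f g : A \in F -> B \in F ->
  s \in A -> s \notin B -> t \in A -> t \notin B ->
  f \in B -> f \notin A -> g \in B -> g \notin A -> ~~ separates f g s t.
Proof.
move=> AF BF sA sB tA tB fB fA gB gA.
apply: contra (family_noncrossing AF BF) => sep.
by apply: separates_crossing sep; apply/setDP.
Qed.

Lemma maximal_mem A :
    #|A| = 3 -> (forall C, C \in F -> ~ crossing A C) -> A \in F.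
Proof.
move=> cardA ncA; case/maxsetP: F_max => /andP[/forall_inP tF /forall_inP nF].
move=> /(_ (A |: F)) <-; rewrite ?setU11 ?subsetUr //.
have crossC B C : crossing B C -> crossing C B.
  case/(crossing_ranks x)=> s [t [f [g [sB tB fC gC ord]]]].
  apply: (@separates_crossing _ x _ _ _ _ _ _ fC gC sB tB).
  by move: ord; rewrite /separates /between; clear; lia.
apply/andP; split; apply/forall_inP=> B.
  by rewrite in_setU1 => /predU1P[->|/tF //]; apply/eqP.
rewrite in_setU1 => BAF; apply/forall_inP=> C; rewrite in_setU1 => CAF.
case/predU1P: BAF => [->|BF]; case/predU1P: CAF => [->|CF].
- by apply/negP=> /exists_inP[a]; rewrite setDv inE.
- exact/negP/ncA.
- by apply/negP=> /crossC; apply: ncA.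
- by have /forall_inP := nF _ BF; apply.
Qed.

Lemma edgeP a b :
  reflect [/\ a != x, b != x, a != b & [set x; a; b] \in F] (edge a b).
Proof.
rewrite /graph_edge /star /= !inE eqxx !andbT negb_or (eq_sym x a) (eq_sym x b).
by rewrite -!andbA; apply: and4P.
Qed.

Lemma edge_sym a b : edge a b = edge b a.
Proof.
by apply/edgeP/edgeP => -[? ? ? ?]; rewrite setUAC; split=> //; rewrite eq_sym.
Qed.

Lemma mem_star_edge C a : C \in F -> x \in C -> a \in C -> a != x ->
  exists2 b, edge a b & C = [set x; a; b].
Proof.
move=> CF xC aC ax.
have [b bC /andP[bx ba]] := triangle_third x a (family_triangle CF).
have defC : C = [set x; a; b].
  by apply: triangle_eq => //; rewrite ?(family_triangle CF) // eq_sym.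
by exists b => //; apply/edgeP; rewrite -defC; split=> //; rewrite eq_sym.
Qed.

(** * Shadowed points *)

Definition shadow C y : bool :=
  [&& x \notin C, y \notin C, [exists c in C, rk c < rk y]
    & [exists e in C, rk y < rk e]].

Definition shadowed y : bool := [exists C in F, shadow C y].

Lemma shadowP C y : reflect
  (exists c e, [/\ x \notin C, y \notin C, c \in C, e \in C
     & rk c < rk y < rk e]) (shadow C y).
Proof.
apply: (iffP and4P) => [[xC yC /exists_inP[c cC cy] /exists_inP[e eC ye]]|].
  by exists c, e; rewrite cy ye.
case=> c [e] [xC yC cC eC /andP[cy ye]].
by split=> //; apply/exists_inP; [exists c | exists e].
Qed.

(** The conclusion on [w] says that [z] is the only point of [C] on its side of
    [y].  Otherwise two points of [C] other than [z] lie on the two sides of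
    [y]; as [x] comes first, they separate [x] from [y], and [C] crosses
    [{x, y, z}]. *)
Lemma shadow_edge C y z : C \in F -> shadow C y -> edge y z ->
  z \in C /\ forall w, w \in C -> w != z -> (rk w < rk y) = (rk y < rk z).
Proof.
move=> CF /shadowP[c [e [xC yC cC eC /andP[cy ye]]]] /edgeP[yx zx yz TF].
have y0 := rank_gt0 x y; have x0 := rank_base x.
have notT w : w \in C -> w != z -> w \notin [set x; y; z].
  move=> wC wz; rewrite !inE !negb_or wz andbT.
  by rewrite (contraNneq _ xC) => [|<-]; rewrite ?(contraNneq _ yC) // => <-.
have alt w1 w2 : w1 \in C -> w1 != z -> w2 \in C -> w2 != z ->
    rk w1 < rk y < rk w2 -> False.
  move=> w1C w1z w2C w2z ord.
  have w10 : 0 < rk w1 by rewrite rank_gt0; apply: contraNneq xC => <-.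
  have /negP[] : ~~ separates w1 w2 x y.
    apply: (@no_separation [set x; y; z] C) => //;
      by rewrite ?notT ?inE ?eqxx ?orbT.
  by rewrite /separates /between; clear -ord w10 x0; lia.
have zC : z \in C.
  have [//|zC] := boolP (z \in C).
  by case: (alt c e) => //; rewrite ?cy ?ye //; apply: contraNneq zC => <-.
split=> // w wC wz.
have wy : rk w != rk y by rewrite eq_rank; apply: contraNneq yC => <-.
have ez : (e == z) = (rk e == rk z) by rewrite eq_rank.
have cz : (c == z) = (rk c == rk z) by rewrite eq_rank.
have [lt_wy|le_yw] := ltnP (rk w) (rk y);
  have [lt_yz|le_zy] := ltnP (rk y) (rk z) => //.
  case: (alt w e) => //; rewrite ?lt_wy // ez.
  by clear -ye le_zy; lia.
case: (alt c w) => //; first by rewrite cz; clear -cy lt_yz; lia.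
by rewrite cy; clear -wy le_yw; lia.
Qed.

(** With two neighbors, each alone on its side of [y], the third point of the
    shadowing triangle would have no side left. *)
Lemma shadowed_unique_neighbor y z z' :
  shadowed y -> edge y z -> edge y z' -> z = z'.
Proof.
case/exists_inP=> C CF sC yz yz'; apply/eqP/negPn/negP=> zz'.
have [zC alone] := shadow_edge CF sC yz.
have [z'C alone'] := shadow_edge CF sC yz'.
have [w wC /andP[wz wz']] := triangle_third z z' (family_triangle CF).
move: (alone _ wC wz) (alone' _ wC wz') (alone' _ zC zz').
have : rk z != rk y by rewrite eq_rank eq_sym; case/edgeP: yz.
have : rk z' != rk y by rewrite eq_rank eq_sym; case/edgeP: yz'.
by clear; lia.
Qed.

(** Since [h] is alone on its side of [g], moving from [g] towards [h] meets no
    point of [C]; so the same triangle shadows all these points, and singles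
    out the same neighbor for them. *)
Lemma shadow_between C g h y : C \in F -> shadow C g -> edge g h ->
  between g h y -> shadow C y.
Proof.
move=> CF sC gh ghy; have [hC alone] := shadow_edge CF sC gh.
case/shadowP: sC => c [e [xC gC cC eC /andP[cg ge]]].
have yC : y \notin C.
  apply/negP=> yC; have := alone y yC; rewrite -(eq_rank x).
  by move: ghy; rewrite /between; clear; lia.
have [ghy'|hgy] := orP ghy; apply/shadowP.
  by exists c, h; split=> //; clear -cg ghy'; lia.
by exists h, e; split=> //; clear -ge hgy; lia.
Qed.

Lemma edge_between g h y z : shadowed g -> edge g h -> between g h y ->
  edge y z -> z = h.
Proof.
case/exists_inP=> C CF sC gh ghy yz; apply/eqP/negPn/negP=> zh.
have [hC alone] := shadow_edge CF sC gh.
have [zC alone'] := shadow_edge CF (shadow_between CF sC gh ghy) yz.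
have [w wC /andP[wh wz]] := triangle_third h z (family_triangle CF).
have hz : h != z by rewrite eq_sym.
move: (alone _ zC zh) (alone _ wC wh) (alone' _ wC wz) (alone' _ hC hz) ghy.
by rewrite /between; clear; lia.
Qed.

Lemma shadowed_between g h y :
  shadowed g -> edge g h -> between g h y -> shadowed y.
Proof.
case/exists_inP=> C CF sC gh ghy; apply/exists_inP.
by exists C => //; apply: shadow_between ghy.
Qed.

(** If [g < h], then [h] is the last point of the triangle shadowing [g], whose
    other points are before [g]; symmetrically [g] is the first point of the
    triangle shadowing [h], whose other points are after [h].  So the chords
    [c h] and [g e] of these two triangles cross. *)
Lemma shadowed_stable g h : shadowed g -> shadowed h -> ~~ edge g h.
Proof.
have wlog g' h' : rk g' < rk h' -> shadowed g' -> shadowed h' -> ~~ edge g' h'.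
  move=> lt_gh /exists_inP[C CF sC] /exists_inP[D DF sD]; apply/negP=> gh.
  have [hC aloneC] := shadow_edge CF sC gh.
  have hg : edge h' g' by rewrite edge_sym.
  have [gD aloneD] := shadow_edge DF sD hg.
  case/shadowP: sC => c [_ [_ gC cC _ /andP[cg _]]].
  case/shadowP: sD => [_ [e [_ hD _ eD /andP[_ he]]]].
  have cD : c \notin D.
    apply/negP=> cD; have := aloneD c cD; rewrite -(eq_rank x).
    by clear -lt_gh cg; lia.
  have eC : e \notin C.
    apply/negP=> eC; have := aloneC e eC; rewrite -(eq_rank x).
    by clear -lt_gh he; lia.
  have := no_separation CF DF cC cD hC hD gD gC eD eC.
  by rewrite /separates /between; clear -cg lt_gh he; lia.
move=> sg sh; case: (ltngtP (rk g) (rk h)) => [|lt_hg|/rank_inj gh].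
- by move/wlog; apply.
- by rewrite edge_sym; apply: wlog.
- by rewrite gh; apply/negP=> /edgeP[_ _]; rewrite eqxx.
Qed.

(** A member crossing [{x, a, b}] shadows [a] or [b] if it avoids [x].  If it
    contains [x], it is an edge from a shadowed point between [a] and [b] to a
    point outside, and then [a] or [b] is between the endpoints of that edge,
    hence shadowed. *)
Lemma consecutive_edge a b : a != x -> ~~ shadowed a -> ~~ shadowed b ->
    rk a < rk b -> (forall y, rk a < rk y < rk b -> shadowed y) -> edge a b.
Proof.
move=> ax sa sb lt_ab gap; have a0 := rank_gt0 x a; have x0 := rank_base x.
have ab : a != b by rewrite -(eq_rank x); clear -lt_ab; lia.
have bx : b != x by rewrite -(eq_rank x); clear -lt_ab x0; lia.
apply/edgeP; split=> //; apply: maximal_mem => [|C CF].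
  by rewrite card_set3 // eq_sym.
case/(crossing_ranks x)=> s [t [f [g [/setDP[sT sC] /setDP[tT tC]]]]].
move=> /setDP[fC fT] /setDP[gC gT] /andP[/andP[sf ft] out].
have shT y : y \in [set x; a; b] -> shadowed y -> y = x.
  rewrite !inE => /orP[/orP[]|] /eqP-> // sy; first by rewrite sy in sa.
  by rewrite sy in sb.
have xC : x \in C.
  apply: contraTT isT => xC; case/orP: out => [gs|tg].
    have /(shT s sT) sx : shadowed s.
      apply/exists_inP; exists C => //; apply/shadowP; exists g, f.
      by rewrite gs sf.
    by move: gs; rewrite sx x0.
  have /(shT t tT) tx : shadowed t.
    apply/exists_inP; exists C => //; apply/shadowP; exists f, g.
    by rewrite ft tg.
  by move: ft; rewrite tx x0.
have fx : f != x by apply: contraNneq fT => ->; rewrite !inE eqxx.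
have [g' fg' defC] := mem_star_edge CF xC fC fx.
have eg : g' = g.
  move: gC; rewrite defC !inE => /orP[/orP[]|] /eqP // eg.
    by move: gT; rewrite eg !inE eqxx.
  by move: out; rewrite eg; clear -sf ft; lia.
have [sab tab] : (s == a) || (s == b) /\ (t == a) || (t == b).
  move: sT tT; rewrite !inE.
  have [sx|_] := eqVneq s x; first by rewrite sx xC in sC.
  by have [tx|_] := eqVneq t x; first by rewrite tx xC in tC.
have [es et] : s = a /\ t = b.
  have st := ltn_trans sf ft.
  case/orP: sab => /eqP es; case/orP: tab => /eqP et; subst s t => //;
    by move: st; clear -lt_ab; lia.
subst s t; have afb : rk a < rk f < rk b by rewrite sf.
have sf' : shadowed f := gap f afb.
rewrite eg in fg'; case/orP: out => [ga|bg].
  case/negP: sa; apply: (shadowed_between sf' fg').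
  by rewrite /between; clear -afb ga; lia.
case/negP: sb; apply: (shadowed_between sf' fg').
by rewrite /between; clear -afb bg; lia.
Qed.

(** * Fans at a point that is not shadowed *)

(** A member crossing [{b, p, q}] but neither [{x, b, p}] nor [{x, b, q}]
    contains [x], so it is an edge of the graph of [x]. *)
Lemma crossing_fan b p q C : C \in F -> edge b p -> edge b q ->
    crossing [set b; p; q] C ->
  exists s t f h, [/\ s \in [set b; p; q] :\ h, t \in [set b; p; q] :\ h,
    f \notin [set b; p; q], edge f h & rk s < rk f < rk t].
Proof.
move=> CF ebp ebq.
have [bx px bp Tp] := edgeP _ _ ebp; have [_ qx bq Tq] := edgeP _ _ ebq.
have x0 := rank_base x.
case/(crossing_ranks x)=> s [t [f [g [/setDP[sT sC] /setDP[tT tC]]]]].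
move=> /setDP[fC fT] /setDP[gC gT] ord.
have sep : separates f g s t.
  by move: ord; rewrite /separates /between; clear; lia.
have fx : f != x by rewrite -(eq_rank x) x0; clear -ord; lia.
have nbp w : w \notin [set b; p; q] -> w != x -> w \notin [set x; b; p].
  by rewrite !inE; do 4!case: (w == _).
have nbq w : w \notin [set b; p; q] -> w != x -> w \notin [set x; b; q].
  by rewrite !inE; do 4!case: (w == _).
have pqT w : w \in [set b; p; q] -> w != b -> (w == p) || (w == q).
  by rewrite !inE; do 3!case: (w == _).
have gx : g = x.
  apply/eqP/negPn/negP=> gx.
  have sepb w : w \in [set b; p; q] -> w != b -> w \notin C -> b \notin C ->
      ~~ separates f g b w.
    move=> wT wb wC bC; case/orP: (pqT w wT wb) => /eqP ew; subst w.
      by apply: (no_separation Tp CF); rewrite ?nbp // !inE eqxx ?orbT.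
    by apply: (no_separation Tq CF); rewrite ?nbq // !inE eqxx ?orbT.
  have [bC|bC] := boolP (b \in C).
    (* [C] is [{b, f, g}], and its chord [f g] separates [x] from [p] or [q]. *)
    have sb' : s != b by apply: contraNneq sC => ->.
    have tb' : t != b by apply: contraNneq tC => ->.
    have xC : x \notin C.
      have fg : f != g by rewrite -(eq_rank x); clear -ord; lia.
      rewrite (triangle_eq (family_triangle CF) bC fC gC) // ?inE ?negb_or.
      - by rewrite ![x == _]eq_sym bx fx gx.
      - by apply: contraNneq fT => <-; rewrite !inE eqxx.
      - by apply: contraNneq gT => <-; rewrite !inE eqxx.
    have sepx w : w \in [set b; p; q] -> w != b -> w \notin C ->
      ~~ separates f g x w.
      move=> wT wb wC; case/orP: (pqT w wT wb) => /eqP ew; subst w.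
        by apply: (no_separation Tp CF); rewrite ?nbp // !inE eqxx ?orbT.
      by apply: (no_separation Tq CF); rewrite ?nbq // !inE eqxx ?orbT.
    have := sepx s sT sb' sC; have := sepx t tT tb' tC.
    have : 0 < rk g by rewrite rank_gt0.
    by move: ord x0; rewrite /separates /between; clear; lia.
  (* The chord [f g] cuts off one or two vertices of [{b, p, q}], hence
     separates [b] from [p] or [q]. *)
  have [esb|sb'] := eqVneq s b.
    have tb' : t != b by rewrite -esb -(eq_rank x); clear -ord; lia.
    by case/negP: (sepb t tT tb' tC bC); rewrite -esb.
  have [etb|tb'] := eqVneq t b.
    case/negP: (sepb s sT sb' sC bC); rewrite -etb.
    by move: sep; rewrite /separates /between; clear; lia.
  have bT : b \in [set b; p; q] by rewrite !inE eqxx.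
  have bf : rk b != rk f by rewrite eq_rank; apply: contraNneq fT => <-.
  have bg : rk b != rk g by rewrite eq_rank; apply: contraNneq gT => <-.
  have := sepb s sT sb' sC bC; have := sepb t tT tb' tC bC.
  by move: ord bf bg; rewrite /separates /between; clear; lia.
subst g; have [h fh defC] := mem_star_edge CF gC fC fx.
have hC : h \in C by rewrite defC !inE eqxx !orbT.
exists s, t, f, h; split=> //; last by case/andP: ord.
  by rewrite in_setD1 sT andbT; apply: contraNneq sC => ->.
by rewrite in_setD1 tT andbT; apply: contraNneq tC => ->.
Qed.

(** Let [f - h] be an edge crossing the triangle, with [f] inside its span.
    Then [f] is shadowed, so [h] is not.  No vertex of the triangle is between
    [f] and [h]: [b] would be shadowed, and [p] or [q] would have [h] as only
    neighbor, so that [h = b].  But [h = b] makes [f] a neighbor of [b] between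
    [p] and [q].  So [h] is the vertex next to [f], and as it is not shadowed
    it is the first or the last of the three vertices; then [f] does not
    separate the other two. *)
Lemma fan_triangle b p q : ~~ shadowed b -> edge b p -> edge b q ->
    rk p < rk q ->
    (forall y, between b p y || between b q y -> shadowed y) ->
    (forall y, rk p < rk y < rk q -> ~~ edge b y) ->
  [set b; p; q] \in F.
Proof.
move=> sb ebp ebq lt_pq gap nonbr.
have [_ _ bp _] := edgeP _ _ ebp; have [_ _ bq _] := edgeP _ _ ebq.
have pq : p != q by rewrite -(eq_rank x); clear -lt_pq; lia.
apply: maximal_mem => [|C CF]; first by rewrite card_set3.
case/(crossing_fan CF ebp ebq)=> s [t [f [h []]]].
move=> /setD1P[hs sT] /setD1P[ht tT] fT fh sft; rewrite eq_sym in hs.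
rewrite eq_sym in ht.
have rkT w y : w \in [set b; p; q] -> y \notin [set b; p; q] -> rk w != rk y.
  by rewrite eq_rank => wT; apply: contraNneq => <-.
have rsT w : w \in [set b; p; q] ->
    [|| rk w == rk b, rk w == rk p | rk w == rk q].
  by rewrite !eq_rank !inE orbA.
have {rsT} [rs rt] := (rsT s sT, rsT t tT).
have [rf_b rf_p rf_q] : [/\ rk b != rk f, rk p != rk f & rk q != rk f].
  by split; apply: rkT => //; rewrite !inE eqxx ?orbT.
have f_in : between b p f || between b q f.
  by move: rs rt sft lt_pq rf_b rf_p rf_q; rewrite /between; clear; lia.
have sf := gap f f_in.
have sh : ~~ shadowed h by apply: contraTN fh => sh; apply: shadowed_stable.
have hgap : ~~ (between b p h || between b q h) by apply: contra sh => /gap.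
have rhs : rk h != rk s by rewrite eq_rank.
have rht : rk h != rk t by rewrite eq_rank.
have hb : h != b.
  apply: contraTneq fh => hb; rewrite edge_sym hb; apply: nonbr.
  by move: rhs rht rs rt sft lt_pq; rewrite hb; clear; lia.
have bh : between f h b = false.
  by apply: contraNF sb; apply: shadowed_between.
have ph : between f h p = false.
  apply: contraNF hb => fhp; rewrite eq_sym; apply/eqP.
  by apply: (edge_between sf fh fhp); rewrite edge_sym.
have qh : between f h q = false.
  apply: contraNF hb => fhq; rewrite eq_sym; apply/eqP.
  by apply: (edge_between sf fh fhq); rewrite edge_sym.
have rhb : rk h != rk b by rewrite eq_rank.
move: rs rt sft lt_pq rf_b rf_p rf_q f_in hgap rhs rht bh ph qh rhb.
by rewrite /between; clear; lia.
Qed.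

(** * Triangulation points are the points that are not shadowed *)

(** A triangle whose complement is a single arc is crossed by nothing.  With
    [x] as a vertex, this gives edges at the two neighbors of [x] on the
    circle, which the search for the next point that is not shadowed cannot
    give. *)
Lemma ear_edge a b : a != x -> b != x -> a != b ->
    (forall y z, y \notin [set x; a; b] -> z \notin [set x; a; b] ->
       rk y < rk z -> ~~ between y z a && ~~ between y z b) ->
  edge a b.
Proof.
move=> ax bx ab ear; apply/edgeP; split=> //; set A := [set x; a; b].
have unsep t y z : t \in A -> y \notin A -> z \notin A ->
    ~~ (rk y < rk t < rk z).
  move=> tA yA zA; apply/negP=> ytz.
  have yz : rk y < rk z by clear -ytz; lia.
  have := ear y z yA zA yz; rewrite /between.
  move: tA ytz; rewrite !inE => /orP[/orP[]|] /eqP-> ytz.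
  - by move: ytz; rewrite rank_base.
  - by rewrite ytz.
  - by rewrite ytz andbF.
apply: maximal_mem => [|C CF]; first by rewrite card_set3 // eq_sym.
case/(crossing_ranks x)=> s [t [f [g [/setDP[sA _] /setDP[tA _]]]]].
move=> /setDP[_ fA] /setDP[_ gA] /andP[/andP[sf ft] /orP[gs|tg]].
  by have /negP[] := unsep s g f sA gA fA; rewrite gs.
by have /negP[] := unsep t f g tA fA gA; rewrite ft.
Qed.

Lemma exists_edge_above y :
  y != x -> ~~ shadowed y -> rk y < n.-1 -> exists2 z, edge y z & rk y < rk z.
Proof.
move=> yx sy ltyn; have [top rtop] : exists a, rk a = n.-1.
  by apply: rank_surj; clear -ltyn; lia.
have Ptop : ~~ shadowed top && (rk y < rk top).
  rewrite rtop ltyn andbT; apply/exists_inP=> -[C _ /shadowP[c [e]]].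
  by case=> _ _ _ _; have := ltn_rank x e; rewrite rtop; clear; lia.
pose above z := ~~ shadowed z && (rk y < rk z).
case: (@arg_minnP _ _ above rk Ptop) => z /andP[sz yz] z_min; exists z => //.
apply: consecutive_edge => // w /andP[yw wz]; apply: contraT => sw.
by have := z_min w; rewrite /above sw yw leqNgt wz; apply.
Qed.

Lemma exists_edge_below y :
  ~~ shadowed y -> 1 < rk y -> exists2 z, edge y z & rk z < rk y.
Proof.
move=> sy lt1y; have [bot rbot] : exists a, rk a = 1.
  by apply: rank_surj; have := ltn_rank x y; clear -lt1y; lia.
have Pbot : [&& ~~ shadowed bot, bot != x & rk bot < rk y].
  rewrite -(rank_gt0 x) rbot lt1y !andbT.
  apply/exists_inP=> -[C _ /shadowP[c [e]]].
  case=> xC _ cC _; have: c != x by apply: contraNneq xC => <-.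
  by rewrite -(rank_gt0 x) rbot; clear; lia.
pose below z := [&& ~~ shadowed z, z != x & rk z < rk y].
case: (@arg_maxnP _ _ below rk Pbot) => z /and3P[sz zx zy] z_max.
exists z => //.
rewrite edge_sym; apply: consecutive_edge => // w /andP[zw wy].
apply: contraT => sw; have := z_max w; rewrite /below sw wy -(rank_gt0 x).
by rewrite (leq_ltn_trans (leq0n _) zw) => /(_ isT); rewrite /= leqNgt zw.
Qed.

Lemma degree_gt1P a :
  reflect (exists b c, [/\ edge a b, edge a c & b != c]) (1 < degree F x a).
Proof.
apply: (iffP card_gt1P) => -[b [c [ab ac bc]]]; exists b, c;
  by move: ab ac; rewrite ?inE.
Qed.

Lemma edge_graph_vertex a b : edge a b -> a \in graph_vertices F x.
Proof.
case/edgeP=> ax _ _ TF; rewrite inE ax; apply/exists_inP.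
by exists [set x; a; b]; rewrite !inE ?TF eqxx ?orbT.
Qed.

(** A point that is not shadowed has a neighbor on each side; only the two
    neighbors of [x] on the circle lack one side, and there an ear replaces
    it.  For [n = 3] all degrees are at most 1. *)
Lemma mem_triangulation_points y : 3 < n ->
  y \in triangulation_points F x = (y != x) && ~~ shadowed y.
Proof.
move=> n_gt3; rewrite inE; apply/andP/andP=> [[_ /degree_gt1P]|[yx sy]].
  case=> z [z' [yz yz' zz']]; have [-> _ _ _] := edgeP _ _ yz; split=> //.
  by apply: contra zz' => sy; rewrite (shadowed_unique_neighbor sy yz yz').
suff deg : 1 < degree F x y.
  split=> //; case/degree_gt1P: deg => z [_ [yz _ _]].
  exact: edge_graph_vertex yz.
have y0 : 0 < rk y by rewrite rank_gt0.
have ear a b : (rk a == 1) && (rk b == 2) ||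
    ((rk b == n.-1) && ((rk a == 1) || (rk a == n.-2))) -> edge a b.
  move=> ab; apply: ear_edge; rewrite -?(eq_rank x) ?rank_base;
    try by clear -ab n_gt3; lia.
  move=> u w; rewrite !inE -!(eq_rank x) rank_base.
  have := ltn_rank x u; have := ltn_rank x w.
  by move: ab n_gt3; rewrite /between; clear; lia.
apply/degree_gt1P; have [y1|y1|y1] := ltngtP 1 (rk y).
- have [yn|yn] := ltnP (rk y) n.-1.
    have [z yz ltyz] := exists_edge_above yx sy yn.
    have [w yw ltwy] := exists_edge_below sy y1.
    by exists z, w; split=> //; rewrite -(eq_rank x); clear -ltyz ltwy; lia.
  have [a ra] : exists a, rk a = 1 by apply: rank_surj; clear -n_gt3; lia.
  have [b rb] : exists b, rk b = n.-2 by apply: rank_surj; clear -n_gt3; lia.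
  have yn' : rk y = n.-1 by have := ltn_rank x y; clear -yn; lia.
  exists a, b; rewrite ![edge y _]edge_sym.
  rewrite !ear -?(eq_rank x) ?ra ?rb ?yn' ?eqxx ?orbT //.
  by split=> //; clear -n_gt3; lia.
- by clear -y0 y1; lia.
have [a ra] : exists a, rk a = 2 by apply: rank_surj; clear -n_gt3; lia.
have [b rb] : exists b, rk b = n.-1 by apply: rank_surj; clear -n_gt3; lia.
exists a, b; rewrite !ear -?(eq_rank x) ?ra ?rb -?y1 ?eqxx ?orbT //.
by split=> //; clear -n_gt3; lia.
Qed.

Lemma sorted_rank_lt (s : seq 'I_n) k l :
  sorted (lt_from x) s -> k < l < size s -> rk (nth x s k) < rk (nth x s l).
Proof.
move=> s_sorted /andP[lt_kl lt_l].
have tr : transitive (lt_from x).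
  by move=> b a c; rewrite !lt_fromE; clear; lia.
have := sorted_ltn_nth tr x s_sorted k l (ltn_trans lt_kl lt_l) lt_l lt_kl.
by rewrite lt_fromE => /andP[].
Qed.

Lemma nth_rank_lt (s : seq 'I_n) k l : sorted (lt_from x) s ->
  k < size s -> l < size s -> rk (nth x s k) < rk (nth x s l) -> k < l.
Proof.
move=> s_sorted ks ls; have [//|lt_lk|->] := ltngtP k l; last by rewrite ltnn.
by rewrite ltnNge ltnW // sorted_rank_lt // lt_lk.
Qed.

Section TriangulationPoints.

Variable v : seq 'I_n.
Hypothesis (v_sorted : sorted (lt_from x) v) (n_gt3 : 3 < n).
Hypothesis v_mem : v =i triangulation_points F x.

Lemma mem_triangulation y : (y \in v) = (y != x) && ~~ shadowed y.
Proof. by rewrite v_mem mem_triangulation_points. Qed.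

Lemma uniq_triangulation : uniq v.
Proof.
apply: (sorted_uniq _ _ v_sorted) => [b a c|a]; rewrite !lt_fromE; last first.
  by rewrite ltnn andbF.
by clear; lia.
Qed.

Lemma consecutive_triangulation k : k.+1 < size v ->
  let a := nth x v k in let b := nth x v k.+1 in
  [/\ edge a b, rk a < rk b & forall y, between a b y -> shadowed y].
Proof.
move=> ks a b; have ks' := ltnW ks.
have [ax sa] : a != x /\ ~~ shadowed a.
  by apply/andP; rewrite -mem_triangulation mem_nth.
have [bx sb] : b != x /\ ~~ shadowed b.
  by apply/andP; rewrite -mem_triangulation mem_nth.
have ab : rk a < rk b by rewrite sorted_rank_lt // ltnSn.
have gap y : rk a < rk y < rk b -> shadowed y.
  move=> /andP[ay yb]; apply: contraT => sy.
  have yx : y != x by rewrite -rank_gt0 (leq_ltn_trans (leq0n _) ay).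
  have yv : y \in v by rewrite mem_triangulation yx.
  move: ay yb; rewrite -(nth_index x yv) => ay yb; rewrite -index_mem in yv.
  have := nth_rank_lt v_sorted ks' yv ay.
  have := nth_rank_lt v_sorted yv ks yb.
  by clear; lia.
split=> // [|y]; first exact: consecutive_edge.
by rewrite /between => /orP[/gap //|]; clear -ab; lia.
Qed.

End TriangulationPoints.

Lemma shadowed_neighbor_leaf b y :
  b != x -> shadowed y -> edge b y -> y \in leaves F x b.
Proof.
move=> bx sy by_; have yb : edge y b by rewrite edge_sym.
rewrite inE yb (edge_graph_vertex yb) andbT /= eqn_leq.
apply/andP; split; last first.
  by rewrite card_gt0; apply/set0Pn; exists b; rewrite inE.
rewrite leqNgt; apply/degree_gt1P=> -[c [d [yc yd /eqP]]]; apply.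
exact: shadowed_unique_neighbor sy yc yd.
Qed.

(** A leaf has degree 1, so it is shadowed, and the points between it and its
    neighbor are shadowed with it.  In particular leaves stay between the
    adjacent triangulation points. *)
Lemma leaf_gap b l : 3 < n -> l \in leaves F x b ->
  [/\ edge b l, shadowed l & forall y, between b l y -> shadowed y].
Proof.
move=> n_gt3; rewrite inE => /andP[lV /andP[/eqP deg lb]].
have sl : shadowed l.
  apply: contraT => sl; have [lx _ _ _] := edgeP _ _ lb.
  by have := mem_triangulation_points l n_gt3; rewrite lx sl inE deg andbF.
split=> // [|y bly]; first by rewrite edge_sym.
by apply: (shadowed_between sl lb); move: bly; rewrite /between orbC.
Qed.

End MaximalFamily.

(** * Assembling the fan of leaves *)

Lemma next_uniq_nth (T : eqType) (x0 : T) (s : seq T) i :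
  uniq s -> i.+1 < size s -> next s (nth x0 s i) = nth x0 s i.+1.
Proof.
case: s => // y s s_uniq lt_is.
rewrite next_nth mem_nth 1?ltnW // index_uniq 1?ltnW //.
by apply: set_nth_default.
Qed.

Lemma prev_uniq_nth (T : eqType) (x0 : T) (s : seq T) i :
  uniq s -> i.+1 < size s -> prev s (nth x0 s i.+1) = nth x0 s i.
Proof.
by move=> s_uniq lt_is; rewrite -(next_uniq_nth x0 s_uniq lt_is) prev_next.
Qed.

Theorem lemma1p18 (n : nat) (F : {set {set 'I_n}})
    (F_max : maximal_weakly_separated_family F) (x : 'I_n)
    (v : seq 'I_n) (v_sorted : sorted (lt_from x) v)
    (v_mem : v =i triangulation_points F x)
    (i : nat) (i_lt : i < size v) (B : 'I_n) (B_eq : B = nth x v i)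
    (P : seq 'I_n) (P_sorted : sorted (lt_from x) P)
    (P_mem : P =i leaves F x B)
    (Q : seq 'I_n) (Q_eq : Q = prev v B :: rcons P (next v B))
    (j : nat) (j_le : j <= size P)
    (not_first : ~ (i = 0 /\ j = 0))
    (not_last : ~ (i = (size v).-1 /\ j = size P)) :
  [set B; nth x Q j; nth x Q j.+1] \in F.
Proof.
have Bv : B \in v by rewrite B_eq mem_nth.
have n_gt3 : 3 < n.
  have := Bv; rewrite v_mem inE => /andP[_ /degree_gt1P[c [d [Bc Bd cd]]]].
  have [Bx cx Bc' _] := edgeP _ _ _ _ Bc; have [_ dx Bd' _] := edgeP _ _ _ _ Bd.
  have : uniq [:: x; B; c; d].
    by rewrite /= !inE !negb_or ![x == _]eq_sym Bx cx dx Bc' Bd' cd.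
  by move/card_uniqP=> /= <-; rewrite -[n in _ <= n]card_ord max_card.
have /andP[Bx sB] : (B != x) && ~~ shadowed F x B.
  by rewrite -(mem_triangulation F_max n_gt3 v_mem).
have v_uniq := uniq_triangulation v_sorted.
have leaf k : k < size P ->
    [/\ graph_edge F x B (nth x P k), shadowed F x (nth x P k)
      & forall y, between x B (nth x P k) y -> shadowed F x y].
  by move=> ks; apply: (leaf_gap F_max n_gt3); rewrite -P_mem mem_nth.
have prevB : 0 < i ->
    [/\ graph_edge F x B (prev v B), rank x (prev v B) < rank x B,
        ~~ shadowed F x (prev v B)
      & forall y, between x B (prev v B) y -> shadowed F x y].
  case: i i_lt B_eq {not_first not_last} => // i i_lt B_eq _.
  have [] := consecutive_triangulation F_max v_sorted n_gt3 v_mem i_lt.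
  rewrite -B_eq; have -> : nth x v i = prev v B by rewrite B_eq prev_uniq_nth.
  move=> e lt gap; split=> //; first by rewrite edge_sym.
    have : prev v B \in v by rewrite mem_prev.
    by rewrite (mem_triangulation F_max n_gt3 v_mem) => /andP[].
  by move=> y; rewrite /between orbC => /gap.
have nextB : i.+1 < size v ->
    [/\ graph_edge F x B (next v B), rank x B < rank x (next v B),
        ~~ shadowed F x (next v B)
      & forall y, between x B (next v B) y -> shadowed F x y].
  move=> lt_iv.
  have [] := consecutive_triangulation F_max v_sorted n_gt3 v_mem lt_iv.
  rewrite -B_eq.
  have -> : nth x v i.+1 = next v B by rewrite B_eq next_uniq_nth.
  move=> e lt gap; split=> //.
  have : next v B \in v by rewrite mem_next.
  by rewrite (mem_triangulation F_max n_gt3 v_mem) => /andP[].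
have i_pos : j = 0 -> 0 < i by case: posnP => // i0 j0; case: not_first.
have i_last : j = size P -> i.+1 < size v.
  move=> jP; rewrite ltnNge; apply/negP=> le_vi; apply: not_last; split=> //.
  by move: i_lt le_vi; clear; lia.
set p := nth x Q j; set q := nth x Q j.+1.
have p0 : j = 0 -> p = prev v B by rewrite /p Q_eq => ->.
have pS k : j = k.+1 -> p = nth x P k.
  by rewrite /p Q_eq => jk /=; rewrite jk /= nth_rcons -jk j_le.
have qP : j < size P -> q = nth x P j by rewrite /q Q_eq /= nth_rcons => ->.
have qlast : j = size P -> q = next v B.
  by rewrite /q Q_eq /= nth_rcons => ->; rewrite ltnn eqxx.
have [ep gapp] :
    graph_edge F x B p /\ forall y, between x B p y -> shadowed F x y.
  case ej : j (j_le) => [|k] lt_k.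
    by rewrite p0 //; case: prevB => //; apply: i_pos.
  by rewrite (pS k) //; case: (leaf k).
have [eq gapq] :
    graph_edge F x B q /\ forall y, between x B q y -> shadowed F x y.
  have [lt_jP|le_Pj] := ltnP j (size P).
    by rewrite qP //; case: (leaf j).
  have jP : j = size P by apply/eqP; rewrite eqn_leq j_le.
  by rewrite qlast //; case: nextB => //; apply: i_last.
(* A triangulation point is never between a leaf of [B] and [B], so the adjacent
   triangulation points enclose all leaves of [B]. *)
have lt_pq : rank x p < rank x q.
  have neq a b : shadowed F x a -> ~~ shadowed F x b -> rank x a != rank x b.
    by rewrite eq_rank => sa; apply: contraNneq => <-.
  have [lt_jP|le_Pj] := ltnP j (size P).
    case ej : j => [|k]; last first.
      by rewrite (pS k) // qP // ej sorted_rank_lt // ltnSn -ej.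
    have [_ ltpB sp _] := prevB (i_pos ej); have [_ sq _] := leaf _ lt_jP.
    have := contra (gapq p); rewrite p0 // => /(_ sp).
    have := neq _ _ sq sp; rewrite -qP //.
    by move: ltpB; rewrite /between; clear; lia.
  have jP : j = size P by apply/eqP; rewrite eqn_leq j_le.
  have [_ ltBq sq _] := nextB (i_last jP); rewrite qlast //.
  case ej : j => [|k].
    by rewrite p0 //; case: (prevB (i_pos ej)) => _ /ltn_trans->.
  have sp : shadowed F x p.
    by rewrite (pS k) //; case: (leaf k) => //; rewrite -jP ej.
  have := contra (gapp (next v B)) sq; have := neq _ _ sp sq.
  by move: ltBq; rewrite /between; clear; lia.
apply: (fan_triangle F_max sB ep eq lt_pq) => [y /orP[/gapp|/gapq] //|y].
move=> /andP[py yq]; apply/negP=> By.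
(* A neighbor [y] of [B] between [p] and [q] would be a leaf of [B], but [p] and
   [q] are consecutive in the list [Q]. *)
have sy : shadowed F x y.
  have [_ _ By' _] := edgeP _ _ _ _ By; rewrite -(eq_rank x) in By'.
  have [lt_yB|le_By] := ltnP (rank x y) (rank x B).
    by apply: gapp; rewrite /between; clear -lt_yB py; lia.
  by apply: gapq; rewrite /between; clear -le_By yq By'; lia.
have yP : y \in P by rewrite P_mem shadowed_neighbor_leaf.
have ltyP : index y P < size P by rewrite index_mem.
rewrite -(nth_index x yP) in py yq.
have le_jy : j <= index y P.
  case ej : j (j_le) => [|k] lt_k //.
  by apply: (nth_rank_lt P_sorted) => //; rewrite -pS.
have lt_jP := leq_ltn_trans le_jy ltyP.
have := nth_rank_lt P_sorted ltyP lt_jP; rewrite -qP // => /(_ yq).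
by rewrite ltnNge le_jy.
Qed.
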